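(* Fix a real number $k>-1$ and $n\in\mathbb{N}=\{1,2,\dots\}$. Define $r_k:=2\sqrt{(k+1)(k+2)}$, $r_{k+1}:=2\sqrt{(k+2)(k+3)}$ and $\hat{r}_k:=\sqrt{2(k+1)(k+3)}$. Then the zeros $j_{k+2,n}$ and $j_{k+3,n}$ lie in the interval $(j_{k+1,n},j_{k+1,n+1})$ and satisfy the following interlacing properties: - if $j_{k,n+1}<r_k$, then $j_{k+1,n}<j_{k+2,n}<j_{k+3,n}<j_{k,n+1}<j_{k+1,n+1}$; - if $j_{k,n+1}>r_k$, then $j_{k+1,n}<j_{k+2,n}<j_{k,n+1}<j_{k+3,n}<j_{k+1,n+1}$. Furthermore, the zero $j_{k+4,n}$ satisfies: - if $j_{k+1,n+1}<r_{k+1}$ and $j_{k,n+1}<\hat{r}_k$, then $j_{k+4,n}\in(j_{k+3,n},j_{k,n+1})$; - if $j_{k+1,n+1}<r_{k+1}$ and $j_{k,n+1}\in(\hat{r}_k,r_k)$, then $j_{k+4,n}\in(j_{k,n+1},j_{k+1,n+1})$; - if $j_{k+1,n+1}<r_{k+1}$ and $j_{k,n+1}>r_k$, then $j_{k+4,n}\in(j_{k+3,n},j_{k+1,n+1})$; - if $j_{k+1,n+1}>r_{k+1}$, then $j_{k+4,n}\in(j_{k+1,n+1},j_{k+2,n+1})$.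
   Context: For real $\nu>-1$, $J_\nu(r)$ denotes the Bessel function of the first kind of order $\nu$, for $r>0$. Its positive zeros, listed in increasing order, are denoted $0<j_{\nu,1}<j_{\nu,2}<\cdots$. *)

(* Defs.v *)
From Stdlib Require Import Reals Factorial ClassicalEpsilon.
From Coquelicot Require Import Coquelicot.
Open Scope R_scope.

(* Euler's integral: this is the Gamma function for [0 < x], which is the only
   range used below, since [nu + m + 1 > 0] whenever [nu > -1]. *)
Definition Gamma (x : R) : R :=
  RInt_gen (fun t => Rpower t (x - 1) * exp (- t))
           (at_right 0) (Rbar_locally p_infty).

(* J_nu(r) = (r/2)^nu * sum_m (-1)^m / (m! Gamma(nu + m + 1)) * (r^2/4)^m,
   for [0 < r] ([Rpower] is the real power only for a positive base). *)
Definition BesselJ (nu r : R) : R :=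
  Rpower (r / 2) nu *
  PSeries (fun m => (-1) ^ m / (INR (fact m) * Gamma (nu + INR m + 1)))
          ((r / 2) ^ 2).

(* [z 1 < z 2 < ...] lists all the positive zeros of J_nu; the value [z 0] is
   unconstrained. *)
Definition lists_positive_zeros (nu : R) (z : nat -> R) : Prop :=
  (forall n : nat, (1 <= n)%nat -> z n < z (S n)) /\
  (forall x : R,
     (0 < x /\ BesselJ nu x = 0) <-> (exists n : nat, (1 <= n)%nat /\ z n = x)).

(* The n-th positive zero j_{nu,n}, for [nu > -1] and [n >= 1].  A list as above
   is unique up to its value at 0, so the choice made by [epsilon] is immaterial
   for [n >= 1]. *)
Definition bessel_zero (nu : R) (n : nat) : R :=
  epsilon (inhabits (fun _ : nat => 0)) (lists_positive_zeros nu) n.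

(* Main.v *)
Require Import Defs.
From Stdlib Require Import Reals Lra Lia Factorial ClassicalEpsilon.
From Coquelicot Require Import Coquelicot.
Open Scope R_scope.

(* Dividing J_nu by (x/2)^nu leaves an even entire function f_nu, positive at 0,
   with f_nu' = -(x/2) f_(nu+1) and f_nu = (nu+1) f_(nu+1) - (x/2)^2 f_(nu+2).
   For nu > -1 its positive zeros are simple, unbounded and locally finite, and
   Rolle's theorem interlaces those of f_nu and f_(nu+1); hence f_nu has sign (-1)^n
   between its n-th and (n+1)-th zeros.  At a zero x of f_k the recurrence expresses
   the three next functions through f_(k+1), with t = (x/2)^2:
     t f_(k+2) = (k+1) f_(k+1),
     t^2 f_(k+3) = ((k+1)(k+2) - t) f_(k+1),
     t^3 f_(k+4) = (k+2)((k+1)(k+3) - 2t) f_(k+1),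
   and the signs of these factors, which change at r_k and at the hatted r_k, decide
   on which side of x the zeros of higher order lie. *)

(** * The Gamma function *)

Definition gamma_integrand (x t : R) : R := Rpower t (x - 1) * exp (- t).

Lemma gamma_integrand_gt_0 (x t : R) : 0 < gamma_integrand x t.
Proof. apply Rmult_lt_0_compat; apply exp_pos. Qed.

Lemma continuous_gamma_integrand (x t : R) :
  0 < t -> continuous (gamma_integrand x) t.
Proof.
  intros Ht; apply (@ex_derive_continuous R_AbsRing R_NormedModule).
  unfold gamma_integrand, Rpower; auto_derive; exact Ht.
Qed.

Lemma is_RInt_gamma_integrand (x a b : R) :
  0 < a -> a <= b ->
  is_RInt (gamma_integrand x) a b (RInt (gamma_integrand x) a b).
Proof.
  intros Ha Hab; apply (@RInt_correct R_CompleteNormedModule).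
  apply (@ex_RInt_continuous R_CompleteNormedModule); intros t Ht.
  rewrite Rmin_left in Ht by lra; apply continuous_gamma_integrand; lra.
Qed.

(** The logarithm lies below its tangent at [y], so the left side is largest at [1 + t = y], where
    it equals the bound. *)
Lemma Rpower_mult_exp_opp_le (y t : R) :
  0 < y -> 0 < t -> Rpower (1 + t) y * exp (- t) <= exp (1 - y + y * ln y).
Proof.
  intros Hy Ht; unfold Rpower; rewrite <- exp_plus.
  assert (H : ln (1 + t) <= ln y + ((1 + t) / y - 1)).
  { replace (1 + t) with (y * ((1 + t) / y)) at 1 by (field; lra).
    assert (0 < (1 + t) / y) by (apply Rdiv_lt_0_compat; lra).
    rewrite ln_mult by assumption.
    generalize (exp_ineq1_le (ln ((1 + t) / y))).
    rewrite exp_ln by assumption; lra. }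
  assert (K : y * ln (1 + t) + - t <= 1 - y + y * ln y).
  { apply Rmult_le_compat_l with (r := y) in H; [|lra].
    replace (y * (ln y + ((1 + t) / y - 1))) with (y * ln y + (1 + t - y)) in H
      by (field; lra).
    lra. }
  destruct K as [K|K]; [left; apply exp_increasing, K | rewrite K; right; reflexivity].
Qed.

(* [(t / (1 + t))^x / x] is a bounded antiderivative of [t^(x-1) / (1 + t)^(x+1)],
   which dominates the integrand at both ends of the half-line. *)
Lemma RInt_gamma_integrand_le (x : R) :
  0 < x ->
  exists M, forall a b, 0 < a -> a <= b -> RInt (gamma_integrand x) a b <= M.
Proof.
  (* [C] is the bound of [Rpower_mult_exp_opp_le] at [y = x + 1]; [P] below is [C] times the
     antiderivative just described, written with [exp] and [ln], and [p] is its derivative. *)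
  intros Hx; set (C := exp (1 - (x + 1) + (x + 1) * ln (x + 1))).
  exists (C / x); intros a b Ha Hab.
  set (P := fun t => C / x * exp (x * (ln t - ln (1 + t)))).
  set (p := fun t => C * (exp (x * (ln t - ln (1 + t))) * (/ t - / (1 + t)))).
  assert (HP : is_RInt p a b (minus (P b) (P a))).
  { apply (@is_RInt_derive R_CompleteNormedModule); intros t Ht;
      rewrite Rmin_left in Ht by lra.
    - unfold P, p, Rminus; auto_derive; [repeat split; lra | field; lra].
    - apply (@ex_derive_continuous R_AbsRing R_NormedModule).
      unfold p; auto_derive; repeat split; lra. }
  apply Rle_trans with (minus (P b) (P a)).
  - rewrite <- (@is_RInt_unique R_CompleteNormedModule _ _ _ _ HP).
    apply RInt_le; [exact Hab | eexists; apply is_RInt_gamma_integrand; lra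
                   | eexists; exact HP |].
    intros t Ht; unfold gamma_integrand, p.
    assert (E : exp (x * (ln t - ln (1 + t))) * (/ t - / (1 + t)) =
                Rpower t (x - 1) * Rpower (1 + t) (- (x + 1))).
    { unfold Rpower; rewrite <- exp_plus.
      replace ((x - 1) * ln t + - (x + 1) * ln (1 + t))
        with (x * (ln t - ln (1 + t)) + - (ln t + ln (1 + t))) by ring.
      rewrite (exp_plus (x * _)), exp_Ropp, exp_plus, !exp_ln by lra.
      field; lra. }
    rewrite E.
    replace (exp (- t)) with
      (Rpower (1 + t) (- (x + 1)) * (Rpower (1 + t) (x + 1) * exp (- t))).
    + assert (H := Rpower_mult_exp_opp_le (x + 1) t ltac:(lra) ltac:(lra)).
      fold C in H.
      assert (0 < Rpower t (x - 1) * Rpower (1 + t) (- (x + 1))).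
      { apply Rmult_lt_0_compat; apply exp_pos. }
      nra.
    + rewrite <- Rmult_assoc, <- Rpower_plus, Rplus_opp_l, Rpower_O; lra.
  (* [P b] is at most [C / x] because [b / (1 + b) < 1], and [P a] is positive. *)
  - assert (0 < C / x) by (apply Rdiv_lt_0_compat; [apply exp_pos | lra]).
    assert (exp (x * (ln b - ln (1 + b))) <= 1).
    { apply Rle_trans with (exp 0); [left; apply exp_increasing | rewrite exp_0; lra].
      assert (ln b < ln (1 + b)) by (apply ln_increasing; lra); nra. }
    assert (0 < exp (x * (ln a - ln (1 + a)))) by apply exp_pos.
    unfold minus, plus, opp, P; simpl; nra.
Qed.

Lemma RInt_gamma_integrand_incl (x a b c d : R) :
  0 < a -> a <= b -> b <= c -> c <= d ->
  RInt (gamma_integrand x) b c <= RInt (gamma_integrand x) a d.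
Proof.
  intros Ha Hab Hbc Hcd.
  assert (E : forall u v, a <= u -> u <= v -> ex_RInt (gamma_integrand x) u v).
  { intros u v Hu Hv; eexists; apply is_RInt_gamma_integrand; lra. }
  assert (N : forall u v, a <= u -> u <= v -> 0 <= RInt (gamma_integrand x) u v).
  { intros u v Hu Hv; apply RInt_ge_0; [exact Hv | apply E; assumption |].
    intros t _; left; apply gamma_integrand_gt_0. }
  assert (H1 := @RInt_Chasles R_CompleteNormedModule (gamma_integrand x) a b d
                  (E a b ltac:(lra) ltac:(lra)) (E b d ltac:(lra) ltac:(lra))).
  assert (H2 := @RInt_Chasles R_CompleteNormedModule (gamma_integrand x) b c d
                  (E b c ltac:(lra) ltac:(lra)) (E c d ltac:(lra) ltac:(lra))).
  unfold plus in H1, H2; simpl in H1, H2.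
  generalize (N a b ltac:(lra) ltac:(lra)) (N c d ltac:(lra) ltac:(lra)); lra.
Qed.

(** Replaces the limit at both ends of the half-line by explicit thresholds for the endpoints. *)
Lemma filter_prod_half_line (P : R * R -> Prop) (a0 b0 : R) :
  0 < a0 ->
  (forall a b, 0 < a < a0 -> b0 < b -> P (a, b)) ->
  filter_prod (at_right 0) (Rbar_locally p_infty) P.
Proof.
  intros Ha HP.
  apply (Filter_prod _ _ _ (fun a => 0 < a < a0) (fun b => b0 < b)).
  - exists (mkposreal a0 Ha); intros y Hy Hy0; split; [exact Hy0|].
    unfold ball in Hy; simpl in Hy; unfold AbsRing_ball, abs, minus, plus, opp in Hy;
      simpl in Hy.
    apply Rabs_def2 in Hy; lra.
  - exists b0; trivial.
  - exact HP.
Qed.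

(** [RInt_gen] carries information only once convergence is known. The integrand is positive, so
    integrals over growing intervals increase, and being bounded they converge to their supremum. *)
Lemma is_RInt_gen_Gamma (x : R) :
  0 < x ->
  is_RInt_gen (gamma_integrand x) (at_right 0) (Rbar_locally p_infty) (Gamma x).
Proof.
  intros Hx.
  set (S := fun v => exists a b, 0 < a /\ a <= b /\ v = RInt (gamma_integrand x) a b).
  destruct (completeness S) as [l [Hub Hlub]].
  - destruct (RInt_gamma_integrand_le x Hx) as [M HM].
    exists M; intros v (a & b & Ha & Hab & ->); apply HM; assumption.
  - exists (RInt (gamma_integrand x) 1 2), 1, 2; repeat split; lra.
  - assert (Hl : is_RInt_gen (gamma_integrand x) (at_right 0)
                   (Rbar_locally p_infty) l).
    { intros P [eps HP].
      assert (Hex : exists a b, 0 < a /\ a <= b /\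
                      l - eps < RInt (gamma_integrand x) a b).
      { destruct (classic (exists a b, 0 < a /\ a <= b /\
                      l - eps < RInt (gamma_integrand x) a b)) as [H|H]; [exact H|].
        exfalso; assert (l <= l - eps); [|destruct eps; simpl in *; lra].
        apply Hlub; intros v (a & b & Ha & Hab & ->).
        apply Rnot_lt_le; intros Hlt; apply H; exists a, b; auto. }
      destruct Hex as (a0 & b0 & Ha0 & Hab0 & Hlt).
      unfold filtermapi.
      apply (filter_prod_half_line _ a0 b0 Ha0); intros a b Ha Hb; simpl.
      exists (RInt (gamma_integrand x) a b); split.
      - apply is_RInt_gamma_integrand; lra.
      - apply HP.
        assert (RInt (gamma_integrand x) a b <= l)
          by (apply Hub; exists a, b; repeat split; lra).
        assert (RInt (gamma_integrand x) a0 b0 <= RInt (gamma_integrand x) a b)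
          by (apply RInt_gamma_integrand_incl; lra).
        unfold ball; simpl; unfold AbsRing_ball, abs, minus, plus, opp; simpl.
        apply Rabs_def1; lra. }
    replace (Gamma x) with l; [exact Hl|].
    symmetry; apply (@is_RInt_gen_unique R_CompleteNormedModule _ _ _ _
                       (gamma_integrand x) l Hl).
Qed.

(** If the limit were at most 0, integrals over large intervals would fall below the positive
    integral over [[1, 2]], which those intervals contain. *)
Lemma Gamma_gt_0 (x : R) : 0 < x -> 0 < Gamma x.
Proof.
  intros Hx.
  assert (H12 : 0 < RInt (gamma_integrand x) 1 2).
  { apply RInt_gt_0; [lra | intros; apply gamma_integrand_gt_0 |].
    intros t Ht; apply continuous_gamma_integrand; lra. }
  apply Rnot_le_lt; intros Hle.
  destruct (is_RInt_gen_Gamma x Hx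
    (fun v => v < RInt (gamma_integrand x) 1 2)) as [Q1 Q2 HQ1 HQ2 HQ].
  - apply (open_lt (RInt (gamma_integrand x) 1 2)); lra.
  - assert (HR : exists a, Q1 a /\ 0 < a <= 1).
    { destruct HQ1 as [d Hd]; exists (Rmin (d / 2) 1).
      assert (0 < Rmin (d / 2) 1) by (destruct d; apply Rmin_pos; simpl; lra).
      assert (Rmin (d / 2) 1 <= d / 2) by apply Rmin_l.
      assert (Rmin (d / 2) 1 <= 1) by apply Rmin_r.
      split; [|lra]; apply Hd; [|assumption].
      unfold ball; simpl; unfold AbsRing_ball, abs, minus, plus, opp; simpl.
      destruct d; simpl in *; apply Rabs_def1; lra. }
    destruct HR as (a & Ha & Ha1); destruct HQ2 as [M HM].
    set (b := Rmax (M + 1) 2).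
    assert (M + 1 <= b) by apply Rmax_l; assert (2 <= b) by apply Rmax_r.
    destruct (HQ a b Ha (HM b ltac:(lra))) as (v & Hv & Hlt); simpl in Hv.
    rewrite <- (@is_RInt_unique R_CompleteNormedModule _ _ _ _ Hv) in Hlt.
    generalize (RInt_gamma_integrand_incl x a 1 2 b); lra.
Qed.

(** One boundary term of the integration by parts in [Gamma_plus_1]. The threshold
    [exp (ln eps / x)] is the solution of [t^x = eps], and the exponential factor is below 1. *)
Lemma filterlim_Rpower_mult_exp_opp_0 (x : R) :
  0 < x -> filterlim (fun t => Rpower t x * exp (- t)) (at_right 0) (locally 0).
Proof.
  intros Hx P [eps HP].
  assert (He := cond_pos eps).
  exists (mkposreal _ (exp_pos (ln eps / x))); intros t Ht Ht0.
  unfold ball in Ht; simpl in Ht; unfold AbsRing_ball, abs, minus, plus, opp in Ht;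
    simpl in Ht; apply Rabs_def2 in Ht.
  apply HP; unfold ball; simpl; unfold AbsRing_ball, abs, minus, plus, opp; simpl.
  assert (0 < Rpower t x) by apply exp_pos; assert (0 < exp (- t)) by apply exp_pos.
  assert (exp (- t) < 1) by (rewrite <- exp_0; apply exp_increasing; lra).
  assert (Rpower t x < eps).
  { rewrite <- (exp_ln eps He); apply exp_increasing.
    assert (Hln : ln t < ln eps / x).
    { rewrite <- (ln_exp (ln eps / x)); apply ln_increasing; lra. }
    apply (Rmult_lt_compat_l x) in Hln; [|exact Hx].
    replace (x * (ln eps / x)) with (ln eps) in Hln by (field; lra); exact Hln. }
  apply Rabs_def1; nra.
Qed.

(** The other boundary term. Spending one more power, [(1 + t)^(x + 1) * exp (- t) <= C] leaves a
    decay of order [C / t]. *)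
Lemma filterlim_Rpower_mult_exp_opp_p_infty (x : R) :
  0 < x ->
  filterlim (fun t => Rpower t x * exp (- t)) (Rbar_locally p_infty) (locally 0).
Proof.
  intros Hx P [eps HP].
  assert (He := cond_pos eps).
  set (C := exp (1 - (x + 1) + (x + 1) * ln (x + 1))).
  assert (HC : 0 < C) by apply exp_pos.
  exists (C / eps); intros t Ht.
  assert (H0 : 0 < C / eps) by (apply Rdiv_lt_0_compat; assumption).
  assert (H := Rpower_mult_exp_opp_le (x + 1) t ltac:(lra) ltac:(lra)).
  fold C in H; rewrite Rpower_plus, Rpower_1 in H by lra.
  apply HP; unfold ball; simpl; unfold AbsRing_ball, abs, minus, plus, opp; simpl.
  assert (0 < Rpower t x) by apply exp_pos; assert (0 < exp (- t)) by apply exp_pos.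
  assert (Rpower t x <= Rpower (1 + t) x) by (apply Rle_Rpower_l; lra).
  assert (C < t * eps).
  { apply (Rmult_lt_compat_r eps) in Ht; [|exact He].
    replace (C / eps * eps) with C in Ht by (field; lra); exact Ht. }
  assert (Rpower t x * exp (- t) <= Rpower (1 + t) x * exp (- t)) by nra.
  assert (0 < Rpower t x * exp (- t)) by nra.
  apply Rabs_def1; [|lra].
  rewrite Ropp_0, Rplus_0_r.
  apply Rmult_lt_reg_l with t; [lra|].
  nra.
Qed.

(** Integration by parts: the derivative of [h] is the difference of the two integrands, and [h]
    vanishes at both ends. *)
Lemma Gamma_plus_1 (x : R) : 0 < x -> Gamma (x + 1) = x * Gamma x.
Proof.
  intros Hx; set (h := fun t => Rpower t x * exp (- t)).
  assert (D : forall t, 0 < t ->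
    is_derive h t (x * gamma_integrand x t - gamma_integrand (x + 1) t)).
  { intros t Ht; unfold h, gamma_integrand, Rpower; auto_derive; [exact Ht|].
    replace ((x + 1 - 1) * ln t) with (x * ln t) by ring.
    replace ((x - 1) * ln t) with (x * ln t + - ln t) by ring.
    rewrite exp_plus, (exp_Ropp (ln t)), exp_ln by exact Ht; field; lra. }
  assert (I : is_RInt_gen (fun t => x * gamma_integrand x t - gamma_integrand (x + 1) t)
                (at_right 0) (Rbar_locally p_infty) (0 - 0)).
  { apply (@is_RInt_gen_ext R_NormedModule _ _ _ _ (Derive h)).
    - apply (filter_prod_half_line _ 1 1 Rlt_0_1); intros a b Ha Hb t Ht.
      simpl in Ht; rewrite Rmin_left in Ht by lra.
      apply is_derive_unique, D; lra.
    - apply (@is_RInt_gen_Derive _ _ _ _ h 0 0).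
      + apply (filter_prod_half_line _ 1 1 Rlt_0_1); intros a b Ha Hb t Ht.
        simpl in Ht; rewrite Rmin_left in Ht by lra.
        eexists; apply D; lra.
      + apply (filter_prod_half_line _ 1 1 Rlt_0_1); intros a b Ha Hb t Ht.
        simpl in Ht; rewrite Rmin_left in Ht by lra.
        (* The formula for [Derive h] holds only at positive arguments, so continuity is transported
           on the ball of radius [t] around [t]. *)
        apply (continuous_ext_loc _
          (fun t => x * gamma_integrand x t - gamma_integrand (x + 1) t)).
        * exists (mkposreal t ltac:(lra)); intros s Hs; symmetry.
          apply is_derive_unique, D.
          unfold ball in Hs; simpl in Hs;
            unfold AbsRing_ball, abs, minus, plus, opp in Hs; simpl in Hs.
          apply Rabs_def2 in Hs; lra.
        * apply (@ex_derive_continuous R_AbsRing R_NormedModule).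
          unfold gamma_integrand, Rpower; auto_derive; lra.
      + apply filterlim_Rpower_mult_exp_opp_0, Hx.
      + apply filterlim_Rpower_mult_exp_opp_p_infty, Hx. }
  assert (J := @is_RInt_gen_minus R_NormedModule _ _ _ _ _ _ _ _
     (@is_RInt_gen_scal R_NormedModule _ _ _ _ _ x _ (is_RInt_gen_Gamma x Hx))
     (is_RInt_gen_Gamma (x + 1) ltac:(lra))).
  apply (@is_RInt_gen_unique R_CompleteNormedModule) in I; [|apply _ ..].
  apply (@is_RInt_gen_unique R_CompleteNormedModule) in J; [|apply _ ..].
  unfold minus, plus, opp, scal in J; simpl in J; unfold mult in J; simpl in J.
  unfold Rminus in I; rewrite I in J; lra.
Qed.

(** * Power series *)

Definition bessel_coeff (nu : R) (m : nat) : R :=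
  (-1) ^ m / (INR (fact m) * Gamma (nu + INR m + 1)).

Lemma Gamma_arg_gt_0 (nu : R) (m : nat) : -1 < nu -> 0 < nu + INR m + 1.
Proof. generalize (pos_INR m); lra. Qed.

Lemma Gamma_coeff_S (nu : R) (m : nat) :
  -1 < nu -> Gamma (nu + INR (S m) + 1) = (nu + INR m + 1) * Gamma (nu + INR m + 1).
Proof.
  intros Hnu; rewrite <- Gamma_plus_1 by (apply Gamma_arg_gt_0, Hnu).
  f_equal; rewrite S_INR; ring.
Qed.

Lemma bessel_coeff_S (nu : R) (m : nat) :
  -1 < nu ->
  bessel_coeff nu (S m) = - bessel_coeff nu m / ((INR m + 1) * (nu + INR m + 1)).
Proof.
  intros Hnu; unfold bessel_coeff; rewrite Gamma_coeff_S by exact Hnu.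
  rewrite fact_simpl, mult_INR, S_INR; simpl pow.
  assert (H1 := INR_fact_lt_0 m); assert (H2 := Gamma_arg_gt_0 nu m Hnu).
  assert (H3 := Gamma_gt_0 _ H2); assert (H4 := pos_INR m).
  field; repeat split; lra.
Qed.

Lemma bessel_coeff_shift (nu : R) (m : nat) :
  -1 < nu ->
  bessel_coeff nu m = (nu + INR m + 1) * bessel_coeff (nu + 1) m.
Proof.
  intros Hnu; unfold bessel_coeff.
  replace (nu + 1 + INR m + 1) with (nu + INR (S m) + 1) by (rewrite S_INR; ring).
  rewrite Gamma_coeff_S by exact Hnu.
  assert (H1 := INR_fact_lt_0 m); assert (H2 := Gamma_arg_gt_0 nu m Hnu).
  assert (H3 := Gamma_gt_0 _ H2).
  field; repeat split; lra.
Qed.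

Lemma bessel_coeff_neq_0 (nu : R) (m : nat) : -1 < nu -> bessel_coeff nu m <> 0.
Proof.
  intros Hnu; unfold bessel_coeff.
  assert (H1 := INR_fact_lt_0 m).
  assert (H3 := Gamma_gt_0 _ (Gamma_arg_gt_0 nu m Hnu)).
  apply Rmult_integral_contrapositive_currified; [apply pow_nonzero; lra|].
  apply Rinv_neq_0_compat; nra.
Qed.

(** By [bessel_coeff_S] the ratio of consecutive coefficients is at most [1 / m] in absolute value,
    since [nu + m + 1 > m]. *)
Lemma CV_radius_bessel_coeff (nu : R) :
  -1 < nu -> CV_radius (bessel_coeff nu) = p_infty.
Proof.
  intros Hnu; apply CV_radius_infinite_DAlembert.
  { intros m; apply bessel_coeff_neq_0, Hnu. }
  apply is_lim_seq_le_le_loc with (u := fun _ => 0) (w := fun m => / INR m).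
  - exists 1%nat; intros m Hm.
    assert (H1 : 1 <= INR m) by (apply (le_INR 1 m Hm)).
    replace (bessel_coeff nu (S m) / bessel_coeff nu m)
      with (- / ((INR m + 1) * (nu + INR m + 1))).
    + rewrite Rabs_Ropp, Rabs_pos_eq.
      * split; [left; apply Rinv_0_lt_compat; nra | apply Rinv_le_contravar; nra].
      * left; apply Rinv_0_lt_compat; nra.
    + rewrite bessel_coeff_S by exact Hnu.
      field; repeat split; [nra | nra | apply bessel_coeff_neq_0, Hnu].
  - apply is_lim_seq_const.
  - replace (Finite 0) with (Rbar_inv p_infty) by reflexivity.
    apply is_lim_seq_inv; [apply is_lim_seq_INR | discriminate].
Qed.

(* [BesselJ nu x = (x / 2)^nu * bessel_entire nu x]. *)
Definition bessel_entire (nu x : R) : R := PSeries (bessel_coeff nu) ((x / 2) ^ 2).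

Lemma BesselJ_eq_0 (nu x : R) : BesselJ nu x = 0 <-> bessel_entire nu x = 0.
Proof.
  change (BesselJ nu x) with (Rpower (x / 2) nu * bessel_entire nu x).
  split; [|intros ->; ring].
  intros H; apply Rmult_integral in H; destruct H as [H|H]; [|exact H].
  generalize (exp_pos (nu * ln (x / 2))); unfold Rpower in H; lra.
Qed.

(** Termwise differentiation in [(x / 2)^2]: [m + 1] times coefficient [m + 1] of order [nu] is
    minus coefficient [m] of order [nu + 1]. The chain rule contributes [x / 2]. *)
Lemma is_derive_bessel_entire (nu x : R) :
  -1 < nu ->
  is_derive (bessel_entire nu) x (- (x / 2) * bessel_entire (nu + 1) x).
Proof.
  intros Hnu.
  assert (H : is_derive (PSeries (bessel_coeff nu)) ((x / 2) ^ 2)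
                (PSeries (PS_derive (bessel_coeff nu)) ((x / 2) ^ 2))).
  { apply is_derive_PSeries; rewrite CV_radius_bessel_coeff by exact Hnu; exact I. }
  assert (E : PSeries (PS_derive (bessel_coeff nu)) ((x / 2) ^ 2) =
              - bessel_entire (nu + 1) x).
  { unfold bessel_entire.
    replace (- PSeries (bessel_coeff (nu + 1)) ((x / 2) ^ 2))
      with (-1 * PSeries (bessel_coeff (nu + 1)) ((x / 2) ^ 2)) by ring.
    rewrite <- PSeries_scal; apply PSeries_ext; intros m.
    unfold PS_derive, PS_scal, scal; simpl; unfold mult; simpl.
    change (match m with O => 1 | S _ => INR m + 1 end) with (INR (S m)).
    rewrite S_INR, bessel_coeff_S, (bessel_coeff_shift nu) by exact Hnu.
    generalize (pos_INR m); intros; field; split; lra. }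
  rewrite E in H.
  unfold bessel_entire at 1.
  replace (- (x / 2) * bessel_entire (nu + 1) x)
    with ((x / 2) * (- bessel_entire (nu + 1) x)) by ring.
  apply (is_derive_comp (PSeries (bessel_coeff nu)) (fun x => (x / 2) ^ 2)).
  - exact H.
  - auto_derive; [exact I | simpl; field].
Qed.

(** Compared coefficientwise: with [a] for [bessel_coeff], [a nu m - (nu + 1) * a (nu + 1) m] is
    [m * a (nu + 1) m], which is [- a (nu + 2) (m - 1)] for positive [m] and 0 for [m = 0]. *)
Lemma bessel_entire_recurrence (nu x : R) :
  -1 < nu ->
  bessel_entire nu x =
  (nu + 1) * bessel_entire (nu + 1) x - (x / 2) ^ 2 * bessel_entire (nu + 2) x.
Proof.
  intros Hnu; unfold bessel_entire; set (t := (x / 2) ^ 2).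
  assert (R1 : forall mu, -1 < mu -> ex_pseries (bessel_coeff mu) t).
  { intros mu Hmu; apply CV_radius_inside.
    rewrite CV_radius_bessel_coeff by exact Hmu; exact I. }
  rewrite <- PSeries_scal, <- (PSeries_incr_1 (bessel_coeff (nu + 2))).
  rewrite <- PSeries_minus.
  - apply PSeries_ext; intros m.
    unfold PS_minus, PS_plus, PS_opp, PS_scal, PS_incr_1, scal, plus, opp; simpl.
    unfold mult; simpl.
    destruct m as [|m].
    + rewrite bessel_coeff_shift by exact Hnu; unfold zero; simpl; ring.
    + rewrite bessel_coeff_shift, bessel_coeff_S by lra.
      rewrite (bessel_coeff_shift (nu + 1)) by lra.
      replace (nu + 1 + 1) with (nu + 2) by ring.
      rewrite S_INR; generalize (pos_INR m); intros; field; lra.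
  - apply (@ex_pseries_scal R_AbsRing R_NormedModule);
      [apply Rmult_comm | apply R1; lra].
  - apply (@ex_pseries_incr_1 R_AbsRing R_NormedModule), R1; lra.
Qed.

Lemma continuity_bessel_entire (nu : R) : -1 < nu -> continuity (bessel_entire nu).
Proof.
  intros Hnu x; apply derivable_continuous_pt.
  eexists; apply is_derive_Reals, is_derive_bessel_entire, Hnu.
Qed.

Lemma bessel_entire_0 (nu : R) : -1 < nu -> 0 < bessel_entire nu 0.
Proof.
  intros Hnu; unfold bessel_entire.
  replace ((0 / 2) ^ 2) with 0 by field.
  rewrite PSeries_0; unfold bessel_coeff; simpl.
  apply Rdiv_lt_0_compat; [lra|].
  generalize (Gamma_gt_0 _ (Gamma_arg_gt_0 nu 0 Hnu)); simpl; lra.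
Qed.

(* [(x / 2) * bessel_entire (nu + 1) x] is [x^(-nu) J_(nu+1)] up to a constant, so
   the pair solves Bessel's equation as a first-order system. *)
Lemma is_derive_bessel_companion (nu x : R) :
  -1 < nu -> x <> 0 ->
  is_derive (fun x => x / 2 * bessel_entire (nu + 1) x) x
    (bessel_entire nu x - (2 * nu + 1) / x * (x / 2 * bessel_entire (nu + 1) x)).
Proof.
  intros Hnu Hx.
  assert (D := is_derive_bessel_entire (nu + 1) x ltac:(lra)).
  replace (bessel_entire nu x - (2 * nu + 1) / x * (x / 2 * bessel_entire (nu + 1) x))
    with (1 / 2 * bessel_entire (nu + 1) x +
          x / 2 * (- (x / 2) * bessel_entire (nu + 1 + 1) x)).
  - apply (@is_derive_mult R_AbsRing (fun x => x / 2)); [|exact D | apply Rmult_comm].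
    auto_derive; [exact I | field].
  - rewrite (bessel_entire_recurrence nu x Hnu).
    replace (nu + 1 + 1) with (nu + 2) by ring; field; exact Hx.
Qed.

(** * Real analysis *)

Lemma MVT_is_derive (f df : R -> R) (a b : R) :
  a < b -> (forall c, a <= c <= b -> is_derive f c (df c)) ->
  exists c, a < c < b /\ f b - f a = df c * (b - a).
Proof.
  intros Hab D.
  destruct (MVT_cor2 f df a b Hab) as (c & H1 & H2).
  - intros c Hc; apply is_derive_Reals, D, Hc.
  - exists c; auto.
Qed.

Lemma Rolle_is_derive (f df : R -> R) (a b : R) :
  a < b -> f a = f b -> (forall c, a <= c <= b -> is_derive f c (df c)) ->
  exists c, a < c < b /\ df c = 0.
Proof.
  intros Hab E D; destruct (MVT_is_derive f df a b Hab D) as (c & Hc & H).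
  exists c; split; [exact Hc|].
  rewrite E, Rminus_diag in H.
  symmetry in H; apply Rmult_integral in H; lra.
Qed.

Lemma is_derive_local_sign (f : R -> R) (x l : R) :
  is_derive f x l -> f x = 0 -> 0 < l ->
  exists d, 0 < d /\ (forall y, x < y < x + d -> 0 < f y) /\
                     (forall y, x - d < y < x -> f y < 0).
Proof.
  intros D E Hl; apply is_derive_Reals in D.
  destruct (D l Hl) as [d Hd]; exists d.
  (* With tolerance [l] the difference quotient stays within [l] of [l], hence positive; as
     [f x = 0], this quotient is [f (x + h) / h]. *)
  assert (K : forall h, h <> 0 -> Rabs h < d -> 0 < f (x + h) / h).
  { intros h Hh Hhd; specialize (Hd h Hh Hhd); rewrite E, Rminus_0_r in Hd.
    apply Rabs_def2 in Hd; lra. }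
  split; [apply cond_pos|]; split; intros y Hy.
  - assert (H := K (y - x) ltac:(lra) ltac:(apply Rabs_def1; lra)).
    replace (x + (y - x)) with y in H by ring.
    apply (Rmult_lt_compat_r (y - x)) in H; [|lra].
    replace (f y / (y - x) * (y - x)) with (f y) in H by (field; lra); lra.
  - assert (H := K (y - x) ltac:(lra) ltac:(apply Rabs_def1; lra)).
    replace (x + (y - x)) with y in H by ring.
    apply (Rmult_lt_compat_r (x - y)) in H; [|lra].
    replace (f y / (y - x) * (x - y)) with (- f y) in H by (field; lra); lra.
Qed.

Lemma continuity_pos_near (f : R -> R) (x : R) :
  continuity_pt f x -> 0 < f x ->
  exists d, 0 < d /\ forall y, Rabs (y - x) < d -> 0 < f y.
Proof.
  intros C Hx.
  destruct (C (f x) Hx) as (d & Hd & H); exists d; split; [exact Hd|].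
  intros y Hy; destruct (Req_dec y x) as [->|N]; [exact Hx|].
  specialize (H y (conj (conj I (not_eq_sym N)) Hy)).
  simpl in H; unfold Rdist in H; apply Rabs_def2 in H; lra.
Qed.

(** [K] treats a positive value or a zero with positive slope; the other cases follow by passing to
    [- f]. *)
Lemma isolated_zero (f : R -> R) (x l : R) :
  is_derive f x l -> f x <> 0 \/ l <> 0 ->
  exists d, 0 < d /\ forall y, 0 < Rabs (y - x) < d -> f y <> 0.
Proof.
  assert (K : forall (f : R -> R) l, is_derive f x l -> 0 < f x \/ f x = 0 /\ 0 < l ->
    exists d, 0 < d /\ forall y, 0 < Rabs (y - x) < d -> f y <> 0).
  { clear f l; intros f l D [H|[E H]].
    - destruct (continuity_pos_near f x) as (d & Hd & Hf); [|exact H|].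
      { apply derivable_continuous_pt; exists l; apply is_derive_Reals, D. }
      exists d; split; [exact Hd|]; intros y Hy; specialize (Hf y ltac:(lra)); lra.
    - destruct (is_derive_local_sign f x l D E H) as (d & Hd & H1 & H2).
      exists d; split; [exact Hd|]; intros y [Hy1 Hy2]; apply Rabs_def2 in Hy2.
      destruct (Rtotal_order y x) as [L|[->|L]].
      + specialize (H2 y ltac:(lra)); lra.
      + rewrite Rminus_diag, Rabs_R0 in Hy1; lra.
      + specialize (H1 y ltac:(lra)); lra. }
  intros D H.
  assert (D' : is_derive (fun y => - f y) x (- l))
    by (apply (@is_derive_opp R_AbsRing R_NormedModule), D).
  destruct (Rlt_or_le 0 (f x)); [apply (K f l D); lra|].
  destruct (Rlt_or_le (f x) 0).
  2:{ destruct (Rlt_or_le 0 l); [apply (K f l D); lra|].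
      destruct (K (fun y => - f y) (- l) D') as (d & Hd & H3); [lra|].
      exists d; split; [exact Hd|]; intros y Hy E; apply (H3 y Hy); lra. }
  destruct (K (fun y => - f y) (- l) D') as (d & Hd & H3); [lra|].
  exists d; split; [exact Hd|]; intros y Hy E; apply (H3 y Hy); lra.
Qed.

Lemma pos_of_no_zero (f : R -> R) (a b c x : R) :
  continuity f -> (forall y, a < y < b -> f y <> 0) ->
  a < c < b -> 0 < f c -> a < x < b -> 0 < f x.
Proof.
  intros C N Hc Hfc Hx.
  destruct (Rlt_or_le 0 (f x)) as [H|H]; [exact H|exfalso].
  destruct (Rle_or_lt c x) as [L|L].
  - destruct (IVT_cor f c x C L) as (z & Hz & E); [nra|].
    apply (N z); [lra | exact E].
  - destruct (IVT_cor f x c C ltac:(lra)) as (z & Hz & E); [nra|].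
    apply (N z); [lra | exact E].
Qed.

(** The infimum of the points beyond [x] is attained: otherwise the gap around it would give a
    larger lower bound. It is taken as minus the supremum of the opposites. *)
Lemma next_of_discrete (P : R -> Prop) (x : R) :
  0 <= x ->
  (forall x, 0 <= x -> exists d, 0 < d /\ forall y, 0 < Rabs (y - x) < d -> ~ P y) ->
  (forall X, exists x, X < x /\ P x) ->
  exists y, x < y /\ P y /\ forall w, x < w -> P w -> y <= w.
Proof.
  intros Hx D U.
  destruct (completeness (fun v => x < - v /\ P (- v))) as [l [Hub Hlub]].
  - exists (- x); intros v [H _]; lra.
  - destruct (U x) as (y & Hy & HP); exists (- y); rewrite Ropp_involutive; auto.
  - assert (B : forall w, x < w -> P w -> - l <= w).
    { intros w Hw HP; assert (- w <= l); [|lra].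
      apply Hub; rewrite Ropp_involutive; auto. }
    assert (G : forall m, (forall w, x < w -> P w -> m <= w) -> m <= - l).
    { intros m Hm; assert (l <= - m); [|lra].
      apply Hlub; intros v [H1 H2]; specialize (Hm _ H1 H2); lra. }
    assert (X : x < - l).
    { destruct (D x Hx) as (d & Hd & H).
      assert (x + d <= - l); [|lra].
      apply G; intros w Hw HP; apply Rnot_lt_le; intros L.
      apply (H w); [rewrite Rabs_pos_eq; lra | exact HP]. }
    exists (- l); split; [exact X|]; split; [|exact B].
    destruct (classic (P (- l))) as [H|H]; [exact H|exfalso].
    destruct (D (- l) ltac:(lra)) as (d & Hd & HD).
    assert (- l + d <= - l); [|lra].
    apply G; intros w Hw HP; apply Rnot_lt_le; intros L.
    specialize (B w Hw HP).
    destruct (Req_dec w (- l)) as [E|N]; [rewrite E in HP; exact (H HP)|].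
    apply (HD w); [rewrite Rabs_pos_eq; lra | exact HP].
Qed.

(** The list iterates the passage to the least later point, starting from [z 0 = 0], which serves
    only as a seed. *)
Lemma discrete_enumeration (P : R -> Prop) :
  (forall x, 0 <= x -> exists d, 0 < d /\ forall y, 0 < Rabs (y - x) < d -> ~ P y) ->
  (forall X, exists x, X < x /\ P x) ->
  exists z : nat -> R,
    (forall n, (1 <= n)%nat -> z n < z (S n)) /\
    (forall x, (0 < x /\ P x) <-> (exists n, (1 <= n)%nat /\ z n = x)).
Proof.
  intros D U.
  set (next := fun x => epsilon (inhabits 0)
                 (fun y => x < y /\ P y /\ forall w, x < w -> P w -> y <= w)).
  assert (Hn : forall x, 0 <= x ->
            x < next x /\ P (next x) /\ forall w, x < w -> P w -> next x <= w).
  { intros x Hx; apply (epsilon_spec (inhabits 0)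
       (fun y => x < y /\ P y /\ forall w, x < w -> P w -> y <= w)).
    apply next_of_discrete; assumption. }
  set (z := fix z n := match n with O => 0 | S m => next (z m) end).
  assert (Z0 : forall n, 0 <= z n).
  { induction n as [|n IH]; simpl; [lra|].
    destruct (Hn (z n) IH) as [H _]; fold (z n); lra. }
  assert (ZS : forall n, z n < z (S n)) by (intros n; apply Hn, Z0).
  exists z; split; [intros n _; apply ZS|].
  intros x; split.
  - intros [Hx HP]; apply NNPP; intros N.
    assert (Zx : forall n, z n < x).
    { induction n as [|n IH]; [exact Hx|].
      destruct (Hn (z n) (Z0 n)) as (_ & _ & H).
      destruct (H x IH HP) as [L|E]; [exact L|exfalso].
      apply N; exists (S n); split; [lia | exact E]. }
    (* A point that is missed bounds the whole list, whose supremum would then be an accumulation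
       point of [P]. *)
    destruct (completeness (fun v => exists n, v = z n)) as [l [Hub Hlub]].
    + exists x; intros v (n & ->); left; apply Zx.
    + exists (z O), O; reflexivity.
    + assert (Zl : forall n, z n < l).
      { intros n; apply Rlt_le_trans with (z (S n)); [apply ZS|].
        apply Hub; exists (S n); reflexivity. }
      destruct (D l) as (d & Hd & H); [left; apply (Zl O)|].
      assert (l <= l - d); [|lra].
      apply Hlub; intros v (n & ->); apply Rnot_lt_le; intros L.
      apply (H (z (S n))).
      * specialize (Zl (S n)); specialize (ZS n).
        rewrite Rabs_left by lra; lra.
      * apply Hn, Z0.
  - intros (n & H1 & <-); destruct n as [|n]; [lia|].
    split; [|apply Hn, Z0].
    apply Rle_lt_trans with (z n); [apply Z0 | apply ZS].
Qed.

(** A counting argument: some term of each list lies in every gap of the other, and the condition on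
    [w 1] fixes which list starts. By induction the witness [m] has index at least [S n], so
    monotonicity bounds the term of index [S n] by it. *)
Lemma interlacing_enumerations (z w : nat -> R) :
  (forall n, (1 <= n)%nat -> z n < z (S n)) ->
  (forall n, (1 <= n)%nat -> w n < w (S n)) ->
  (exists m, (1 <= m)%nat /\ z m < w 1%nat) ->
  (forall n, (1 <= n)%nat -> exists m, (1 <= m)%nat /\ z n < w m < z (S n)) ->
  (forall n, (1 <= n)%nat -> exists m, (1 <= m)%nat /\ w n < z m < w (S n)) ->
  forall n, (1 <= n)%nat -> z n < w n < z (S n).
Proof.
  intros Hz Hw H0 Hzw Hwz.
  assert (Mono : forall u : nat -> R, (forall n, (1 <= n)%nat -> u n < u (S n)) ->
            forall p q, (1 <= p)%nat -> (p <= q)%nat -> u p <= u q).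
  { intros u Hu p q Hp Hpq; induction Hpq as [|q Hpq IH]; [lra|].
    specialize (Hu q ltac:(lia)); lra. }
  induction n as [|n IH]; intros Hn; [lia|].
  assert (L : z (S n) < w (S n)).
  { destruct n as [|n].
    - destruct H0 as (m & Hm & H0).
      generalize (Mono z Hz 1%nat m ltac:(lia) ltac:(lia)); lra.
    - specialize (IH ltac:(lia)).
      destruct (Hwz (S n) ltac:(lia)) as (m & Hm & H1).
      destruct (Compare_dec.le_lt_dec m (S n)) as [Hle|Hlt].
      + generalize (Mono z Hz m (S n) Hm Hle); lra.
      + generalize (Mono z Hz (S (S n)) m ltac:(lia) ltac:(lia)); lra. }
  split; [exact L|].
  destruct (Hzw (S n) ltac:(lia)) as (m & Hm & H1).
  destruct (Compare_dec.le_lt_dec (S n) m) as [Hle|Hlt].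
  - generalize (Mono w Hw (S n) m ltac:(lia) Hle); lra.
  - specialize (IH ltac:(lia)).
    generalize (Mono w Hw m n Hm ltac:(lia)); lra.
Qed.

(** * Zeros of one function and interlacing of two *)

(* Up to a factor, [x^(2 nu + 2)] times the bracket is
   [x^2 (J_nu^2 - J_(nu-1) J_(nu+1))]; its derivative is [2 x J_nu^2], so that it
   stays positive and excludes common zeros. *)
Lemma bessel_entire_no_common_zero (nu x : R) :
  -1 < nu -> 0 < x -> bessel_entire nu x = 0 -> bessel_entire (nu + 1) x <> 0.
Proof.
  intros Hnu Hx Ea Eb.
  set (G := fun x => bessel_entire nu x ^ 2
                     - nu * (bessel_entire nu x * bessel_entire (nu + 1) x)
                     + (x / 2) ^ 2 * bessel_entire (nu + 1) x ^ 2).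
  set (F := fun x => exp ((2 * nu + 2) * ln x) * G x).
  set (f := fun x => 2 * exp ((2 * nu + 2) * ln x) / x * bessel_entire nu x ^ 2).
  assert (Da : forall y, is_derive (bessel_entire nu) y
                           (- (y / 2) * bessel_entire (nu + 1) y)).
  { intros y; apply is_derive_bessel_entire, Hnu. }
  assert (Db : forall y, is_derive (bessel_entire (nu + 1)) y
                           (- (y / 2) * bessel_entire (nu + 1 + 1) y)).
  { intros y; apply is_derive_bessel_entire; lra. }
  assert (DG : forall y, is_derive G y
     (- y * bessel_entire nu y * bessel_entire (nu + 1) y
      - nu * (- (y / 2) * bessel_entire (nu + 1) y ^ 2
              - (y / 2) * bessel_entire nu y * bessel_entire (nu + 1 + 1) y)
      + (y / 2) * bessel_entire (nu + 1) y ^ 2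
      - (y / 2) ^ 2 * bessel_entire (nu + 1) y * y * bessel_entire (nu + 1 + 1) y)).
  { intros y; unfold G; auto_derive.
    - repeat split;
        match goal with
        | |- context [nu + 1] => exact (ex_intro _ _ (Db y))
        | |- _ => exact (ex_intro _ _ (Da y))
        end.
    - rewrite (is_derive_unique (fun x : R => bessel_entire nu x) _ _ (Da y)).
      rewrite (is_derive_unique (fun x : R => bessel_entire (nu + 1) x) _ _ (Db y)).
      field. }
  assert (DF : forall y, 0 < y -> is_derive F y (f y)).
  { intros y Hy; unfold F, f; auto_derive.
    - repeat split; [exact Hy | eexists; apply DG].
    - rewrite (is_derive_unique (fun x : R => G x) _ _ (DG y)); unfold G.
      rewrite (bessel_entire_recurrence nu y Hnu).
      replace (nu + 1 + 1) with (nu + 2) by ring; field; lra. }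
  (* At 0 the recurrence turns [G] into [(nu + 1) * bessel_entire (nu + 1) 0 ^ 2]. *)
  assert (G0 : 0 < G 0).
  { unfold G; rewrite (bessel_entire_recurrence nu 0 Hnu).
    assert (H := bessel_entire_0 (nu + 1) ltac:(lra)).
    match goal with |- 0 < ?r =>
      replace r with ((nu + 1) * bessel_entire (nu + 1) 0 ^ 2) by field end.
    apply Rmult_lt_0_compat; [lra | apply pow_lt, H]. }
  destruct (continuity_pos_near G 0) as (d & Hd & HG); [|exact G0|].
  { apply derivable_continuous_pt; eexists; apply is_derive_Reals, DG. }
  (* A point left of [x] and close enough to 0 for [G y > 0]: from there [F] would have to decrease
     to [F x = 0] against its nonnegative derivative. *)
  set (y := Rmin (d / 2) (x / 2)).
  assert (Hy : 0 < y) by (apply Rmin_pos; lra).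
  assert (y <= d / 2) by apply Rmin_l; assert (y <= x / 2) by apply Rmin_r.
  destruct (MVT_is_derive F f y x) as (c & Hc & E); [lra | intros; apply DF; lra |].
  assert (Fy : 0 < F y).
  { apply Rmult_lt_0_compat; [apply exp_pos|].
    apply HG; rewrite Rminus_0_r, Rabs_pos_eq; lra. }
  assert (Fx : F x = 0) by (unfold F, G; rewrite Ea, Eb; ring).
  assert (0 <= f c); [|nra].
  apply Rmult_le_pos; [|apply pow2_ge_0].
  left; apply Rdiv_lt_0_compat; [|lra].
  apply Rmult_lt_0_compat; [lra | apply exp_pos].
Qed.

(* As long as [bessel_entire nu] has no zero, the Pruefer angle [atan p] grows at
   least at rate [1 / 2], which it can do only on an interval of length [2 PI]. *)
Lemma bessel_entire_oscillates (nu X : R) :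
  -1 < nu -> exists x, X < x /\ bessel_entire nu x = 0.
Proof.
  intros Hnu; apply NNPP; intros N.
  (* Beyond [Y] there is no zero, and the damping coefficient [(2 * nu + 1) / x] is at most 1 in
     absolute value. *)
  set (Y := Rmax (X + 1) (Rabs (2 * nu + 1) + 1)).
  assert (Y1 : X + 1 <= Y) by apply Rmax_l.
  assert (Y2 : Rabs (2 * nu + 1) + 1 <= Y) by apply Rmax_r.
  assert (Y0 := Rabs_pos (2 * nu + 1)).
  assert (Hu : forall x, Y <= x -> bessel_entire nu x <> 0).
  { intros x Hx E; apply N; exists x; split; [lra | exact E]. }
  set (v := fun x => x / 2 * bessel_entire (nu + 1) x).
  set (p := fun x => v x / bessel_entire nu x).
  (* The Riccati equation of the quotient, read off from the first-order system. *)
  assert (Dp : forall x, Y <= x ->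
            is_derive p x (1 + p x ^ 2 - (2 * nu + 1) / x * p x)).
  { intros x Hx.
    assert (Dv := is_derive_bessel_companion nu x Hnu ltac:(lra)); fold v in Dv.
    assert (Du := is_derive_bessel_entire nu x Hnu).
    unfold p; auto_derive.
    - repeat split; [eexists; exact Dv | eexists; exact Du | apply Hu, Hx].
    - rewrite (is_derive_unique (fun x : R => v x) _ _ Dv).
      rewrite (is_derive_unique (fun x : R => bessel_entire nu x) _ _ Du).
      change (x / 2 * bessel_entire (nu + 1) x) with (v x).
      replace (- (x / 2) * bessel_entire (nu + 1) x) with (- v x) by (unfold v; ring).
      field; split; [apply Hu, Hx | lra]. }
  assert (HPI := PI_RGT_0).
  destruct (MVT_is_derive (fun x => atan (p x))
     (fun x => (1 + p x ^ 2 - (2 * nu + 1) / x * p x) / (1 + p x ^ 2))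
     Y (Y + 2 * PI)) as (c & Hc & E); [lra | |].
  - intros x Hx; assert (D := Dp x ltac:(lra)).
    auto_derive; [eexists; exact D|].
    rewrite (is_derive_unique (fun x : R => p x) _ _ D).
    field; generalize (pow2_ge_0 (p x)); simpl; lra.
  - assert (B1 := atan_bound (p Y)); assert (B2 := atan_bound (p (Y + 2 * PI))).
    assert (K : / 2 <= (1 + p c ^ 2 - (2 * nu + 1) / c * p c) / (1 + p c ^ 2));
      [|nra].
    assert (Q : 0 < 1 + p c ^ 2) by (generalize (pow2_ge_0 (p c)); lra).
    apply Rmult_le_reg_r with (1 + p c ^ 2); [exact Q|].
    replace ((1 + p c ^ 2 - (2 * nu + 1) / c * p c) / (1 + p c ^ 2) * (1 + p c ^ 2))
      with (1 + p c ^ 2 - (2 * nu + 1) / c * p c) by (field; lra).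
    assert (S : Rabs ((2 * nu + 1) / c) <= 1).
    { unfold Rdiv; rewrite Rabs_mult, (Rabs_pos_eq (/ c));
        [|left; apply Rinv_0_lt_compat; lra].
      apply Rmult_le_reg_r with c; [lra|].
      rewrite Rmult_assoc, Rinv_l; lra. }
    apply Rabs_le_between in S.
    set (s := (2 * nu + 1) / c) in *.
    (* The sum of [T1] and [T2] says [1 + p^2 >= 2 * s * p], so [1 + p^2 - s * p] is at least half
       of [1 + p^2]. *)
    assert (T1 : 0 <= (1 + s) * (1 - p c) ^ 2)
      by (apply Rmult_le_pos; [lra | apply pow2_ge_0]).
    assert (T2 : 0 <= (1 - s) * (1 + p c) ^ 2)
      by (apply Rmult_le_pos; [lra | apply pow2_ge_0]).
    nra.
Qed.

(** At a positive zero the derivative is a nonzero multiple of [bessel_entire (nu + 1) x], which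
    cannot vanish there too; at 0 the function is positive. *)
Lemma bessel_entire_discrete (nu x : R) :
  -1 < nu -> 0 <= x ->
  exists d, 0 < d /\ forall y, 0 < Rabs (y - x) < d -> bessel_entire nu y <> 0.
Proof.
  intros Hnu Hx.
  apply isolated_zero with (1 := is_derive_bessel_entire nu x Hnu).
  destruct (Req_dec (bessel_entire nu x) 0) as [E|E]; [right | left; exact E].
  destruct Hx as [Hx|<-].
  - apply Rmult_integral_contrapositive_currified; [lra|].
    apply bessel_entire_no_common_zero; assumption.
  - generalize (bessel_entire_0 nu Hnu); lra.
Qed.

(** The choice by [epsilon] has its property once some list exists; discreteness and unboundedness
    of the zeros provide one. *)
Lemma bessel_zero_spec (nu : R) :
  -1 < nu -> lists_positive_zeros nu (bessel_zero nu).
Proof.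
  intros Hnu; unfold bessel_zero.
  apply (epsilon_spec (inhabits (fun _ : nat => 0)) (lists_positive_zeros nu)).
  destruct (discrete_enumeration (fun x => bessel_entire nu x = 0)) as (z & H1 & H2).
  - intros x; apply bessel_entire_discrete, Hnu.
  - intros X; apply bessel_entire_oscillates, Hnu.
  - exists z; split; [exact H1|].
    intros x; rewrite BesselJ_eq_0; apply H2.
Qed.

Lemma bessel_zero_S (nu : R) (n : nat) :
  -1 < nu -> (1 <= n)%nat -> bessel_zero nu n < bessel_zero nu (S n).
Proof. intros Hnu; apply (bessel_zero_spec nu Hnu). Qed.

Lemma bessel_zero_gt_0 (nu : R) (n : nat) :
  -1 < nu -> (1 <= n)%nat -> 0 < bessel_zero nu n.
Proof.
  intros Hnu Hn; apply (proj2 (bessel_zero_spec nu Hnu)); exists n; auto.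
Qed.

Lemma bessel_entire_zero (nu : R) (n : nat) :
  -1 < nu -> (1 <= n)%nat -> bessel_entire nu (bessel_zero nu n) = 0.
Proof.
  intros Hnu Hn; apply BesselJ_eq_0.
  apply (proj2 (bessel_zero_spec nu Hnu)); exists n; auto.
Qed.

Lemma bessel_entire_zero_inv (nu x : R) :
  -1 < nu -> 0 < x -> bessel_entire nu x = 0 ->
  exists n, (1 <= n)%nat /\ bessel_zero nu n = x.
Proof.
  intros Hnu Hx E; apply (proj2 (bessel_zero_spec nu Hnu)).
  split; [exact Hx | apply BesselJ_eq_0, E].
Qed.

Lemma bessel_zero_le (nu : R) (m n : nat) :
  -1 < nu -> (1 <= m)%nat -> (m <= n)%nat -> bessel_zero nu m <= bessel_zero nu n.
Proof.
  intros Hnu Hm Hmn; induction Hmn as [|n Hmn IH]; [lra|].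
  generalize (bessel_zero_S nu n Hnu ltac:(lia)); lra.
Qed.

(** Index 0 is given the value 0, so that the stretch before the first zero counts as a gap like the
    others. *)
Definition bessel_zero0 (nu : R) (n : nat) : R :=
  match n with O => 0 | S _ => bessel_zero nu n end.

Lemma bessel_zero0_ge_0 (nu : R) (n : nat) : -1 < nu -> 0 <= bessel_zero0 nu n.
Proof.
  intros Hnu; destruct n as [|n]; simpl; [lra|].
  left; apply bessel_zero_gt_0; [exact Hnu | lia].
Qed.

Lemma bessel_zero0_S (nu : R) (n : nat) :
  -1 < nu -> bessel_zero0 nu n < bessel_zero nu (S n).
Proof.
  intros Hnu; destruct n as [|n]; simpl.
  - apply bessel_zero_gt_0; [exact Hnu | lia].
  - apply bessel_zero_S; [exact Hnu | lia].
Qed.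

Lemma bessel_entire_neq_0_between (nu x : R) (n : nat) :
  -1 < nu -> bessel_zero0 nu n < x < bessel_zero nu (S n) -> bessel_entire nu x <> 0.
Proof.
  intros Hnu Hx E.
  assert (H0 := bessel_zero0_ge_0 nu n Hnu).
  destruct (bessel_entire_zero_inv nu x Hnu ltac:(lra) E) as (m & Hm & <-).
  destruct (Compare_dec.le_lt_dec m n) as [L|L].
  - destruct n as [|n]; [lia|].
    generalize (bessel_zero_le nu m (S n) Hnu Hm L); simpl in Hx; lra.
  - generalize (bessel_zero_le nu (S n) m Hnu ltac:(lia) L); lra.
Qed.

Lemma continuity_sign_bessel_entire (nu : R) (n : nat) :
  -1 < nu -> continuity (fun x => (-1) ^ n * bessel_entire nu x).
Proof. intros Hnu; apply continuity_scal, continuity_bessel_entire, Hnu. Qed.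

(** Positive at 0, the function changes sign at each zero because all of them are simple. *)
Lemma bessel_entire_sign (nu : R) (n : nat) (x : R) :
  -1 < nu -> bessel_zero0 nu n < x < bessel_zero nu (S n) ->
  0 < (-1) ^ n * bessel_entire nu x.
Proof.
  intros Hnu; revert x; induction n as [|n IH]; intros x Hx.
  - destruct (continuity_pos_near (bessel_entire nu) 0) as (d & Hd & H).
    { apply continuity_bessel_entire, Hnu. }
    { apply bessel_entire_0, Hnu. }
    simpl in Hx.
    set (c := Rmin (d / 2) (x / 2)).
    assert (Hc : 0 < c) by (apply Rmin_pos; lra).
    assert (c <= d / 2) by apply Rmin_l; assert (c <= x / 2) by apply Rmin_r.
    rewrite pow_O, Rmult_1_l.
    apply (pos_of_no_zero (bessel_entire nu) 0 (bessel_zero nu 1) c);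
      [apply continuity_bessel_entire, Hnu | | lra | | lra].
    + intros y Hy; apply (bessel_entire_neq_0_between nu y 0 Hnu); simpl; lra.
    + apply H; rewrite Rminus_0_r, Rabs_pos_eq; lra.
  - simpl bessel_zero0 in Hx; set (z := bessel_zero nu (S n)) in *.
    assert (Z0 : 0 < z) by (apply bessel_zero_gt_0; [exact Hnu | lia]).
    assert (Ez : bessel_entire nu z = 0)
      by (apply bessel_entire_zero; [exact Hnu | lia]).
    set (l := (-1) ^ S n * (- (z / 2) * bessel_entire (nu + 1) z)).
    assert (D : is_derive (fun x => (-1) ^ S n * bessel_entire nu x) z l).
    { apply (is_derive_scal (bessel_entire nu)), is_derive_bessel_entire, Hnu. }
    assert (Hl : l <> 0).
    { apply Rmult_integral_contrapositive_currified; [apply pow_nonzero; lra|].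
      apply Rmult_integral_contrapositive_currified; [lra|].
      apply bessel_entire_no_common_zero; assumption. }
    (* A negative slope at [z] would contradict the sign known on the gap to its left; [c] is taken
       inside that gap and close to [z]. *)
    assert (Lpos : 0 < l).
    { apply Rnot_le_lt; intros L.
      destruct (is_derive_local_sign (fun x => - ((-1) ^ S n * bessel_entire nu x))
                  z (- l)) as (d & Hd & _ & H).
      - apply (@is_derive_opp R_AbsRing R_NormedModule), D.
      - rewrite Ez; ring.
      - lra.
      - set (c := Rmax (z - d / 2) ((bessel_zero0 nu n + z) / 2)).
        assert (K := bessel_zero0_S nu n Hnu); fold z in K.
        assert (z - d / 2 <= c) by apply Rmax_l.
        assert ((bessel_zero0 nu n + z) / 2 <= c) by apply Rmax_r.
        assert (c < z) by (apply Rmax_lub_lt; lra).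
        specialize (H c ltac:(lra)); specialize (IH c ltac:(lra)).
        rewrite <- tech_pow_Rmult in H; lra. }
    destruct (is_derive_local_sign _ z l D) as (d & Hd & H & _);
      [rewrite Ez; ring | exact Lpos |].
    (* A point just right of [z] where the slope gives the sign, which then spreads over the whole
       zero-free gap. *)
    set (c := Rmin (z + d / 2) ((z + x) / 2)).
    assert (z < c) by (apply Rmin_glb_lt; lra).
    assert (c <= z + d / 2) by apply Rmin_l; assert (c <= (z + x) / 2) by apply Rmin_r.
    apply (pos_of_no_zero (fun x => (-1) ^ S n * bessel_entire nu x)
             z (bessel_zero nu (S (S n))) c);
      [apply continuity_sign_bessel_entire, Hnu | | lra | apply H; lra | lra].
    intros y Hy; apply Rmult_integral_contrapositive_currified.
    + apply pow_nonzero; lra.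
    + apply (bessel_entire_neq_0_between nu y (S n) Hnu Hy).
Qed.

(** A wrong sign for gap [n] at a point beyond the start of that gap means that its right end has
    been passed. The next lemma argues likewise from the right, in gap [S n]. *)
Lemma bessel_zero_lt_of_sign (nu : R) (n : nat) (x : R) :
  -1 < nu -> bessel_zero0 nu n < x ->
  (-1) ^ n * bessel_entire nu x < 0 -> bessel_zero nu (S n) < x.
Proof.
  intros Hnu Hx H; apply Rnot_le_lt; intros [L|E].
  - generalize (bessel_entire_sign nu n x Hnu (conj Hx L)); lra.
  - rewrite E, bessel_entire_zero in H; [lra | exact Hnu | lia].
Qed.

Lemma lt_bessel_zero_of_sign (nu : R) (n : nat) (x : R) :
  -1 < nu -> x < bessel_zero nu (S (S n)) ->
  0 < (-1) ^ n * bessel_entire nu x -> x < bessel_zero nu (S n).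
Proof.
  intros Hnu Hx H; apply Rnot_le_lt; intros [L|E].
  - generalize (bessel_entire_sign nu (S n) x Hnu (conj L Hx)).
    rewrite <- tech_pow_Rmult; lra.
  - rewrite <- E, bessel_entire_zero in H; [lra | exact Hnu | lia].
Qed.

(* Rolle's theorem for [bessel_entire nu] and for
   [x^(2 nu + 2) bessel_entire (nu + 1) x], whose derivative is
   [2 x^(2 nu + 1) bessel_entire nu x]. *)
Lemma bessel_zero_interlacing (nu : R) (n : nat) :
  -1 < nu -> (1 <= n)%nat ->
  bessel_zero nu n < bessel_zero (nu + 1) n < bessel_zero nu (S n).
Proof.
  intros Hnu.
  assert (Hnu1 : -1 < nu + 1) by lra.
  set (g := fun x => exp ((2 * nu + 1) * ln x) * (x / 2 * bessel_entire (nu + 1) x)).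
  set (dg := fun x => exp ((2 * nu + 1) * ln x) * bessel_entire nu x).
  assert (Dg : forall x, 0 < x -> is_derive g x (dg x)).
  { intros x Hx.
    assert (D := is_derive_bessel_companion nu x Hnu ltac:(lra)).
    set (v := fun x => x / 2 * bessel_entire (nu + 1) x) in D.
    change g with (fun x => exp ((2 * nu + 1) * ln x) * v x); unfold dg.
    auto_derive; [repeat split; [exact Hx | eexists; exact D]|].
    rewrite (is_derive_unique (fun x : R => v x) _ _ D).
    unfold v; field; lra. }
  assert (Eg : forall x, bessel_entire (nu + 1) x = 0 -> g x = 0).
  { intros x E; unfold g; rewrite E; ring. }
  assert (Edg : forall x, dg x = 0 -> bessel_entire nu x = 0).
  { intros x E; apply Rmult_integral in E; destruct E as [E|E]; [|exact E].
    generalize (exp_pos ((2 * nu + 1) * ln x)); lra. }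
  revert n; apply interlacing_enumerations.
  - intros n; apply bessel_zero_S, Hnu.
  - intros n; apply bessel_zero_S, Hnu1.
  (* If the first zero [w] of order [nu + 1] came no later than that of order [nu], then [g] would
     increase on [[w / 2, w]] from a positive value to [g w = 0]. *)
  - exists 1%nat; split; [lia|]; apply Rnot_le_lt; intros L.
    set (w := bessel_zero (nu + 1) 1) in *.
    assert (W0 : 0 < w) by (apply bessel_zero_gt_0; [exact Hnu1 | lia]).
    assert (Ew : g w = 0) by (apply Eg, bessel_entire_zero; [exact Hnu1 | lia]).
    destruct (MVT_is_derive g dg (w / 2) w) as (c & Hc & E);
      [lra | intros; apply Dg; lra |].
    assert (0 < dg c).
    { apply Rmult_lt_0_compat; [apply exp_pos|].
      generalize (bessel_entire_sign nu 0 c Hnu); simpl; lra. }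
    assert (0 < g (w / 2)).
    { apply Rmult_lt_0_compat; [apply exp_pos|].
      generalize (bessel_entire_sign (nu + 1) 0 (w / 2) Hnu1); fold w; simpl; nra. }
    nra.
  - intros n Hn.
    assert (H0 := bessel_zero_gt_0 nu n Hnu Hn).
    destruct (Rolle_is_derive (bessel_entire nu)
                (fun x => - (x / 2) * bessel_entire (nu + 1) x)
                (bessel_zero nu n) (bessel_zero nu (S n))) as (c & Hc & E).
    + apply bessel_zero_S; assumption.
    + rewrite !bessel_entire_zero; try assumption; [reflexivity | lia].
    + intros c _; apply is_derive_bessel_entire, Hnu.
    + apply Rmult_integral in E; destruct E as [E|E]; [lra|].
      destruct (bessel_entire_zero_inv (nu + 1) c Hnu1 ltac:(lra) E) as (m & Hm & <-).
      exists m; auto.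
  - intros n Hn.
    assert (H0 := bessel_zero_gt_0 (nu + 1) n Hnu1 Hn).
    destruct (Rolle_is_derive g dg (bessel_zero (nu + 1) n) (bessel_zero (nu + 1) (S n)))
      as (c & Hc & E).
    + apply bessel_zero_S; assumption.
    + rewrite !Eg; [reflexivity | apply bessel_entire_zero; [exact Hnu1 | lia] ..].
    + intros c Hc; apply Dg; lra.
    + destruct (bessel_entire_zero_inv nu c Hnu ltac:(lra) (Edg c E)) as (m & Hm & <-).
      exists m; auto.
Qed.

(** * Shifts by more than one *)

(** Interlacing puts this zero in gap [S m] of order [nu + 1]. This is the reference sign for all
    the higher orders. *)
Lemma bessel_entire_succ_at_zero_sign (nu : R) (m : nat) :
  -1 < nu -> (-1) ^ m * bessel_entire (nu + 1) (bessel_zero nu (S (S m))) < 0.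
Proof.
  intros Hnu.
  assert (H1 := bessel_zero_interlacing nu (S m) Hnu ltac:(lia)).
  assert (H2 := bessel_zero_interlacing nu (S (S m)) Hnu ltac:(lia)).
  assert (H := bessel_entire_sign (nu + 1) (S m) (bessel_zero nu (S (S m)))
                 ltac:(lra) (conj (proj2 H1) (proj1 H2))).
  rewrite <- tech_pow_Rmult in H; lra.
Qed.

Lemma bessel_entire_plus_2_at_zero (nu x : R) :
  -1 < nu -> bessel_entire nu x = 0 ->
  (x / 2) ^ 2 * bessel_entire (nu + 2) x = (nu + 1) * bessel_entire (nu + 1) x.
Proof. intros Hnu E; generalize (bessel_entire_recurrence nu x Hnu); lra. Qed.

Lemma bessel_entire_plus_3_at_zero (nu x : R) :
  -1 < nu -> bessel_entire nu x = 0 ->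
  (x / 2) ^ 4 * bessel_entire (nu + 3) x =
  ((nu + 1) * (nu + 2) - (x / 2) ^ 2) * bessel_entire (nu + 1) x.
Proof.
  intros Hnu E.
  assert (H2 := bessel_entire_plus_2_at_zero nu x Hnu E).
  assert (H3 := bessel_entire_recurrence (nu + 1) x ltac:(lra)).
  replace (nu + 1 + 1) with (nu + 2) in H3 by ring.
  replace (nu + 1 + 2) with (nu + 3) in H3 by ring.
  replace ((x / 2) ^ 4 * bessel_entire (nu + 3) x)
    with ((x / 2) ^ 2 * ((x / 2) ^ 2 * bessel_entire (nu + 3) x)) by ring.
  replace ((x / 2) ^ 2 * bessel_entire (nu + 3) x)
    with ((nu + 2) * bessel_entire (nu + 2) x - bessel_entire (nu + 1) x) by lra.
  replace ((x / 2) ^ 2 * ((nu + 2) * bessel_entire (nu + 2) x - bessel_entire (nu + 1) x))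
    with ((nu + 2) * ((x / 2) ^ 2 * bessel_entire (nu + 2) x)
          - (x / 2) ^ 2 * bessel_entire (nu + 1) x) by ring.
  rewrite H2; ring.
Qed.

Lemma bessel_entire_plus_4_at_zero (nu x : R) :
  -1 < nu -> bessel_entire nu x = 0 ->
  (x / 2) ^ 6 * bessel_entire (nu + 4) x =
  (nu + 2) * ((nu + 1) * (nu + 3) - 2 * (x / 2) ^ 2) * bessel_entire (nu + 1) x.
Proof.
  intros Hnu E.
  assert (H2 := bessel_entire_plus_2_at_zero nu x Hnu E).
  assert (H3 := bessel_entire_plus_3_at_zero nu x Hnu E).
  assert (H4 := bessel_entire_recurrence (nu + 2) x ltac:(lra)).
  replace (nu + 2 + 1) with (nu + 3) in H4 by ring.
  replace (nu + 2 + 2) with (nu + 4) in H4 by ring.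
  replace ((x / 2) ^ 6 * bessel_entire (nu + 4) x)
    with ((x / 2) ^ 4 * ((x / 2) ^ 2 * bessel_entire (nu + 4) x)) by ring.
  replace ((x / 2) ^ 2 * bessel_entire (nu + 4) x)
    with ((nu + 3) * bessel_entire (nu + 3) x - bessel_entire (nu + 2) x) by lra.
  replace ((x / 2) ^ 4 * ((nu + 3) * bessel_entire (nu + 3) x - bessel_entire (nu + 2) x))
    with ((nu + 3) * ((x / 2) ^ 4 * bessel_entire (nu + 3) x)
          - (x / 2) ^ 2 * ((x / 2) ^ 2 * bessel_entire (nu + 2) x)) by ring.
  rewrite H2, H3; ring.
Qed.

(** Transfers the reference sign through the identities above: [a] is a power of [x / 2], [s] the
    value of order [nu + 1], and [c] the factor whose sign decides. *)
Lemma neg_of_mult_pow (a b c s : R) (m : nat) :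
  0 < a -> a * b = c * s -> (-1) ^ m * s < 0 -> 0 < c -> (-1) ^ m * b < 0.
Proof.
  intros Ha E Hs Hc.
  assert (a * ((-1) ^ m * b) = c * ((-1) ^ m * s)) by (rewrite <- !Rmult_assoc,
    !(Rmult_comm _ ((-1) ^ m)), !Rmult_assoc, E; reflexivity).
  nra.
Qed.

Lemma pos_of_mult_pow (a b c s : R) (m : nat) :
  0 < a -> a * b = c * s -> (-1) ^ m * s < 0 -> c < 0 -> 0 < (-1) ^ m * b.
Proof.
  intros Ha E Hs Hc.
  assert (a * ((-1) ^ m * b) = c * ((-1) ^ m * s)) by (rewrite <- !Rmult_assoc,
    !(Rmult_comm _ ((-1) ^ m)), !Rmult_assoc, E; reflexivity).
  nra.
Qed.

(** The deciding factor [nu + 1] is positive. The induction provides that [x] lies beyond the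
    previous zero of order [nu + 2], as the sign criterion requires. *)
Lemma bessel_zero_plus_2_lt (nu : R) (m : nat) :
  -1 < nu -> bessel_zero (nu + 2) (S m) < bessel_zero nu (S (S m)).
Proof.
  intros Hnu; induction m as [|m IH].
  all: match goal with |- _ < ?z => set (x := z) end.
  all: assert (Hx : 0 < x) by (apply bessel_zero_gt_0; [exact Hnu | lia]).
  all: apply bessel_zero_lt_of_sign; [lra | |
         apply (neg_of_mult_pow ((x / 2) ^ 2) _ (nu + 1) (bessel_entire (nu + 1) x));
         [apply pow_lt; lra
         | apply bessel_entire_plus_2_at_zero;
             [exact Hnu | apply bessel_entire_zero; [exact Hnu | lia]]
         | apply bessel_entire_succ_at_zero_sign, Hnu
         | lra]].
  - exact Hx.
  - generalize (bessel_zero_S nu (S (S m)) Hnu ltac:(lia)); fold x; simpl; lra.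
Qed.

(** Provides the location required by the sign criterion at order [nu + 3], through the shift by two
    from order [nu + 1]. *)
Lemma bessel_zero0_plus_3_lt (nu : R) (m : nat) :
  -1 < nu -> bessel_zero0 (nu + 3) m < bessel_zero nu (S (S m)).
Proof.
  intros Hnu; destruct m as [|m]; simpl.
  - apply bessel_zero_gt_0; [exact Hnu | lia].
  - assert (H1 := bessel_zero_plus_2_lt (nu + 1) m ltac:(lra)).
    replace (nu + 1 + 2) with (nu + 3) in H1 by ring.
    assert (H2 := bessel_zero_interlacing nu (S (S m)) Hnu ltac:(lia)); lra.
Qed.

Lemma bessel_zero_plus_3_lt (nu : R) (m : nat) :
  -1 < nu -> (bessel_zero nu (S (S m)) / 2) ^ 2 < (nu + 1) * (nu + 2) ->
  bessel_zero (nu + 3) (S m) < bessel_zero nu (S (S m)).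
Proof.
  intros Hnu; set (x := bessel_zero nu (S (S m))); intros H.
  assert (Hx : 0 < x) by (apply bessel_zero_gt_0; [exact Hnu | lia]).
  apply bessel_zero_lt_of_sign; [lra | apply bessel_zero0_plus_3_lt, Hnu |].
  apply (neg_of_mult_pow ((x / 2) ^ 4) _ ((nu + 1) * (nu + 2) - (x / 2) ^ 2)
           (bessel_entire (nu + 1) x));
    [apply pow_lt; lra | | apply bessel_entire_succ_at_zero_sign, Hnu | lra].
  apply bessel_entire_plus_3_at_zero; [exact Hnu|].
  apply bessel_entire_zero; [exact Hnu | lia].
Qed.

(** Here the factor is negative; three successive interlacings place [x] before the next zero of
    order [nu + 3]. *)
Lemma lt_bessel_zero_plus_3 (nu : R) (m : nat) :
  -1 < nu -> (nu + 1) * (nu + 2) < (bessel_zero nu (S (S m)) / 2) ^ 2 ->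
  bessel_zero nu (S (S m)) < bessel_zero (nu + 3) (S m).
Proof.
  intros Hnu; set (x := bessel_zero nu (S (S m))); intros H.
  assert (Hx : 0 < x) by (apply bessel_zero_gt_0; [exact Hnu | lia]).
  apply lt_bessel_zero_of_sign; [lra | |].
  - assert (H1 := bessel_zero_interlacing nu (S (S m)) Hnu ltac:(lia)).
    assert (H2 := bessel_zero_interlacing (nu + 1) (S (S m)) ltac:(lra) ltac:(lia)).
    assert (H3 := bessel_zero_interlacing (nu + 1 + 1) (S (S m)) ltac:(lra) ltac:(lia)).
    replace (nu + 1 + 1 + 1) with (nu + 3) in H3 by ring; fold x in H1; lra.
  - apply (pos_of_mult_pow ((x / 2) ^ 4) _ ((nu + 1) * (nu + 2) - (x / 2) ^ 2)
             (bessel_entire (nu + 1) x));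
      [apply pow_lt; lra | | apply bessel_entire_succ_at_zero_sign, Hnu | lra].
    apply bessel_entire_plus_3_at_zero; [exact Hnu|].
    apply bessel_entire_zero; [exact Hnu | lia].
Qed.

(** The bound at order [nu + 1] locates [x] beyond the previous zero of order [nu + 4]; the bound at
    order [nu] makes the deciding factor positive. *)
Lemma bessel_zero_plus_4_lt (nu : R) (m : nat) :
  -1 < nu ->
  (bessel_zero (nu + 1) (S (S m)) / 2) ^ 2 < (nu + 2) * (nu + 3) ->
  2 * (bessel_zero nu (S (S m)) / 2) ^ 2 < (nu + 1) * (nu + 3) ->
  bessel_zero (nu + 4) (S m) < bessel_zero nu (S (S m)).
Proof.
  intros Hnu; set (x := bessel_zero nu (S (S m))); intros H1 H.
  assert (Hx : 0 < x) by (apply bessel_zero_gt_0; [exact Hnu | lia]).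
  apply bessel_zero_lt_of_sign; [lra | |].
  - destruct m as [|m]; [exact Hx|]; simpl bessel_zero0.
    assert (Hy : 0 < bessel_zero (nu + 1) (S (S m)))
      by (apply bessel_zero_gt_0; [lra | lia]).
    assert (Hyz := bessel_zero_S (nu + 1) (S (S m)) ltac:(lra) ltac:(lia)).
    assert (H2 := bessel_zero_plus_3_lt (nu + 1) m ltac:(lra)).
    replace (nu + 1 + 3) with (nu + 4) in H2 by ring.
    assert (H3 := bessel_zero_interlacing nu (S (S m)) Hnu ltac:(lia)); fold x in H3.
    (* The bound passes from the zero of order [nu + 1] to the preceding, smaller one, where the
       shift by three applies. *)
    apply Rlt_trans with (2 := proj2 H3), H2; simpl in H1 |- *; nra.
  - apply (neg_of_mult_pow ((x / 2) ^ 6) _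
             ((nu + 2) * ((nu + 1) * (nu + 3) - 2 * (x / 2) ^ 2))
             (bessel_entire (nu + 1) x));
      [apply pow_lt; lra | | apply bessel_entire_succ_at_zero_sign, Hnu
      | apply Rmult_lt_0_compat; lra].
    apply bessel_entire_plus_4_at_zero; [exact Hnu|].
    apply bessel_entire_zero; [exact Hnu | lia].
Qed.

Lemma lt_bessel_zero_plus_4 (nu : R) (m : nat) :
  -1 < nu ->
  (nu + 1) * (nu + 3) < 2 * (bessel_zero nu (S (S m)) / 2) ^ 2 ->
  bessel_zero nu (S (S m)) < bessel_zero (nu + 4) (S m).
Proof.
  intros Hnu; set (x := bessel_zero nu (S (S m))); intros H.
  assert (Hx : 0 < x) by (apply bessel_zero_gt_0; [exact Hnu | lia]).
  apply lt_bessel_zero_of_sign; [lra | |].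
  - assert (H1 := bessel_zero_interlacing nu (S (S m)) Hnu ltac:(lia)).
    assert (H2 := bessel_zero_interlacing (nu + 1) (S (S m)) ltac:(lra) ltac:(lia)).
    assert (H3 := bessel_zero_interlacing (nu + 1 + 1) (S (S m)) ltac:(lra) ltac:(lia)).
    assert (H4 := bessel_zero_interlacing (nu + 1 + 1 + 1) (S (S m))
                    ltac:(lra) ltac:(lia)).
    replace (nu + 1 + 1 + 1 + 1) with (nu + 4) in H4 by ring; fold x in H1; lra.
  - apply (pos_of_mult_pow ((x / 2) ^ 6) _
             ((nu + 2) * ((nu + 1) * (nu + 3) - 2 * (x / 2) ^ 2))
             (bessel_entire (nu + 1) x));
      [apply pow_lt; lra | | apply bessel_entire_succ_at_zero_sign, Hnu | nra].
    apply bessel_entire_plus_4_at_zero; [exact Hnu|].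
    apply bessel_entire_zero; [exact Hnu | lia].
Qed.

(** * Square-root thresholds and the interlacing theorem *)

Lemma lt_sqrt_sqr_lt (x a : R) : 0 < x -> 0 <= a -> x < sqrt a -> x ^ 2 < a.
Proof.
  intros Hx Ha H; generalize (sqrt_def a Ha); intros E; simpl; nra.
Qed.

Lemma sqrt_lt_lt_sqr (x a : R) : 0 <= a -> sqrt a < x -> a < x ^ 2.
Proof.
  intros Ha H; generalize (sqrt_def a Ha) (sqrt_pos a); intros E H0; simpl; nra.
Qed.

Theorem theorem5 (k : R) (n : nat) (hk : -1 < k) (hn : (1 <= n)%nat) :
  let j := bessel_zero in
  let r_k := 2 * sqrt ((k + 1) * (k + 2)) in
  let r_k1 := 2 * sqrt ((k + 2) * (k + 3)) in
  let rhat_k := sqrt (2 * (k + 1) * (k + 3)) in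
  (j (k + 1) n < j (k + 2) n < j (k + 1) (n + 1)%nat) /\
  (j (k + 1) n < j (k + 3) n < j (k + 1) (n + 1)%nat) /\
  (j k (n + 1)%nat < r_k ->
     j (k + 1) n < j (k + 2) n /\
     j (k + 2) n < j (k + 3) n /\
     j (k + 3) n < j k (n + 1)%nat /\
     j k (n + 1)%nat < j (k + 1) (n + 1)%nat) /\
  (r_k < j k (n + 1)%nat ->
     j (k + 1) n < j (k + 2) n /\
     j (k + 2) n < j k (n + 1)%nat /\
     j k (n + 1)%nat < j (k + 3) n /\
     j (k + 3) n < j (k + 1) (n + 1)%nat) /\
  (j (k + 1) (n + 1)%nat < r_k1 -> j k (n + 1)%nat < rhat_k ->
     j (k + 3) n < j (k + 4) n < j k (n + 1)%nat) /\
  (j (k + 1) (n + 1)%nat < r_k1 -> rhat_k < j k (n + 1)%nat < r_k ->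
     j k (n + 1)%nat < j (k + 4) n < j (k + 1) (n + 1)%nat) /\
  (j (k + 1) (n + 1)%nat < r_k1 -> r_k < j k (n + 1)%nat ->
     j (k + 3) n < j (k + 4) n < j (k + 1) (n + 1)%nat) /\
  (r_k1 < j (k + 1) (n + 1)%nat ->
     j (k + 1) (n + 1)%nat < j (k + 4) n < j (k + 2) (n + 1)%nat).
Proof.
  intros j r_k r_k1 rhat_k; unfold j.
  destruct n as [|m]; [lia|].
  replace (S m + 1)%nat with (S (S m)) by lia.
  assert (I0 := bessel_zero_interlacing k (S (S m)) hk ltac:(lia)).
  assert (I1 := bessel_zero_interlacing (k + 1) (S m) ltac:(lra) ltac:(lia)).
  assert (I2 := bessel_zero_interlacing (k + 2) (S m) ltac:(lra) ltac:(lia)).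
  assert (I3 := bessel_zero_interlacing (k + 3) (S m) ltac:(lra) ltac:(lia)).
  assert (L0 := bessel_zero_plus_2_lt k m hk).
  assert (L1 := bessel_zero_plus_2_lt (k + 1) m ltac:(lra)).
  assert (L2 := bessel_zero_plus_2_lt (k + 2) m ltac:(lra)).
  assert (A3 := bessel_zero_plus_3_lt k m hk).
  assert (B3 := lt_bessel_zero_plus_3 k m hk).
  (* The shift by three from order [k + 1] compares order [k + 4] with [y], which is where [r_k1]
     enters. *)
  assert (A3' := bessel_zero_plus_3_lt (k + 1) m ltac:(lra)).
  assert (B3' := lt_bessel_zero_plus_3 (k + 1) m ltac:(lra)).
  assert (A4 := bessel_zero_plus_4_lt k m hk).
  assert (B4 := lt_bessel_zero_plus_4 k m hk).
  assert (X := bessel_zero_gt_0 k (S (S m)) hk ltac:(lia)).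
  assert (Y := bessel_zero_gt_0 (k + 1) (S (S m)) ltac:(lra) ltac:(lia)).
  replace (k + 1 + 1) with (k + 2) in * by ring.
  replace (k + 1 + 2) with (k + 3) in * by ring.
  replace (k + 2 + 1) with (k + 3) in * by ring.
  replace (k + 2 + 2) with (k + 4) in * by ring.
  replace (k + 1 + 3) with (k + 4) in * by ring.
  replace (k + 3 + 1) with (k + 4) in * by ring.
  set (x := bessel_zero k (S (S m))) in *.
  set (y := bessel_zero (k + 1) (S (S m))) in *.
  assert (P0 : 0 <= (k + 1) * (k + 2)) by nra.
  assert (P1 : 0 <= (k + 2) * (k + 3)) by nra.
  assert (P2 : 0 <= 2 * (k + 1) * (k + 3)) by nra.
  assert (R0 : x < r_k -> (x / 2) ^ 2 < (k + 1) * (k + 2))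
    by (intros; apply lt_sqrt_sqr_lt; unfold r_k in *; lra).
  assert (S0 : r_k < x -> (k + 1) * (k + 2) < (x / 2) ^ 2)
    by (intros; apply sqrt_lt_lt_sqr; unfold r_k in *; lra).
  assert (R1 : y < r_k1 -> (y / 2) ^ 2 < (k + 2) * (k + 3))
    by (intros; apply lt_sqrt_sqr_lt; unfold r_k1 in *; lra).
  assert (S1 : r_k1 < y -> (k + 2) * (k + 3) < (y / 2) ^ 2)
    by (intros; apply sqrt_lt_lt_sqr; unfold r_k1 in *; lra).
  assert (R2 : x < rhat_k -> 2 * (x / 2) ^ 2 < (k + 1) * (k + 3)).
  { intros H; apply lt_sqrt_sqr_lt in H; [|lra..]; lra. }
  assert (S2 : rhat_k < x -> (k + 1) * (k + 3) < 2 * (x / 2) ^ 2).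
  { intros H; apply sqrt_lt_lt_sqr in H; [|lra..]; lra. }
  (* In each case the assumed threshold inequalities activate the matching comparisons; what remains
     is a chain of linear inequalities. *)
  repeat match goal with |- _ /\ _ => split | |- _ -> _ => intro end;
    try specialize (R0 ltac:(lra)); try specialize (S0 ltac:(lra));
    try specialize (R1 ltac:(lra)); try specialize (S1 ltac:(lra));
    try specialize (R2 ltac:(lra)); try specialize (S2 ltac:(lra));
    try specialize (A3 ltac:(lra)); try specialize (B3 ltac:(lra));
    try specialize (A3' ltac:(lra)); try specialize (B3' ltac:(lra));
    try specialize (A4 R1 R2); try specialize (B4 S2); lra.
Qed.
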